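(* Let $M=\mathbb{R}/\mathbb{Z}$, let $f_0:M\to M$ be a $C^2$ local diffeomorphism with a unique saddle-node fixed point $0$ ($f_0(0)=0$, $f_0'(0)=1$, $f_0''(0)>0$), such that $|f_0'(x)|>1$ for all $x\in M\setminus W_0$, where $W_0$ is the connected component containing $0$ of $\{x: f_0^k(x)\to0\}$, and let $(f_t)_t$ be a generic unfolding of $f_0$. Let $t_0>0$ be such that for each $t\in(0,t_0)$ the map $f_t$ is uniformly expanding and has a unique ergodic absolutely continuous invariant probability $\mu_t$. Let $\mu_0$ be a weak$^*$ accumulation point of $\mu_t$ as $t\to0^+$. Then there exists a finite measurable partition $\xi$ of $M$ which is a generating partition for $f_t$ modulo $\mu_t$-null sets for every $t\in(0,t_0)$, and such that $\mu_0(\partial\xi)=0$, i.e. the boundaries of the atoms of $\xi$ have $\mu_0$-measure zero.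
   Context: A generic unfolding of $f_0$ is a one-parameter family of $C^2$ local diffeomorphisms $f_t:M\to M$ with $f(x,t)=f_t(x)$, $f(\cdot,0)=f_0$, $f(0,0)=0$, $\partial_xf(0,0)=1$, $\partial_x^2f(0,0)>0$, $\partial_tf(0,0)>0$. A finite partition $\xi$ is generating for $f_t$ mod $\mu_t$ if $\bigvee_{j\ge0}f_t^{-j}\xi$ equals the Borel $\sigma$-algebra of $M$ modulo $\mu_t$-null sets. *)

(* Defs.v *)
(* The circle M = R/Z is represented through
   1-periodic lifts on R: points of M are the points of [0,1), a map of M
   is given by a lift F : R -> R, measures on M are measures on R carried
   by [0,1). *)
From HB Require Import structures.
From mathcomp Require Import all_boot all_order all_algebra.
From mathcomp Require Import all_classical all_reals all_analysis.
Set Implicit Arguments. Unset Strict Implicit. Unset Printing Implicit Defensive.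
Import Order.TTheory GRing.Theory Num.Theory.
Import numFieldNormedType.Exports.
Local Open Scope classical_set_scope.
Local Open Scope ring_scope.

Section Circle.
Variable R : realType.

(* fractional part: the projection R -> M = R/Z, with values in [0,1) *)
Definition fracpart (x : R) : R := x - (Num.floor x)%:~R.

Definition I01 : set R := `[0%R, 1%R[%classic.

(* distance on M from (the class of) y to 0 *)
Definition cdist0 (y : R) : R := Num.min (fracpart y) (1 - fracpart y).

Definition dx (F : R -> R -> R) : R -> R -> R :=
  fun x t => derive1 (fun y => F y t) x.
Definition dt (F : R -> R -> R) : R -> R -> R :=
  fun x t => derive1 (fun s => F x s) t.

Definition jcont (G : R -> R -> R) : Prop :=
  continuous (fun p : R * R => G p.1 p.2).

Definition C1_2var (G : R -> R -> R) : Prop :=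
  (forall x t, derivable (fun y => G y t) x 1) /\
  (forall x t, derivable (fun s => G x s) t 1) /\
  jcont G /\ jcont (dx G) /\ jcont (dt G).

Definition C2_2var (F : R -> R -> R) : Prop :=
  C1_2var F /\ C1_2var (dx F) /\ C1_2var (dt F).

Definition circle_local_diffeo_family (F : R -> R -> R) : Prop :=
  (exists d : int, forall x t, F (x + 1) t = F x t + d%:~R) /\
  (forall x t, dx F x t != 0).

(* Generic unfolding of f_0 = F(.,0) (for the lift normalised by F(0,0)=0) *)
Definition generic_unfolding (F : R -> R -> R) : Prop :=
  C2_2var F /\ circle_local_diffeo_family F /\
  F 0 0 = 0 /\ dx F 0 0 = 1 /\ dx (dx F) 0 0 > 0 /\ dt F 0 0 > 0.

Definition circ (F : R -> R -> R) (t : R) (x : R) : R := fracpart (F x t).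

Definition saddle_node_fixed (g : R -> R) (p : R) : Prop :=
  fracpart (g p) = fracpart p /\ derive1 g p = 1 /\ derive1 (derive1 g) p != 0.

Definition basin0 (g : R -> R) : set R :=
  [set x | (fun k : nat => cdist0 (iter k g x)) @ \oo --> (0 : R)].

(* lift of W_0 : the points of R whose class lies in the connected component
   containing 0 of the basin (seen in M) *)
Definition W0lift (g : R -> R) : set R :=
  [set x | exists k : int, connected_component (basin0 g) 0 (x + k%:~R)].

Definition unif_expanding (g : R -> R) : Prop :=
  exists C lam : R, 0 < C /\ 1 < lam /\
    forall (n : nat) x, derivable (iter n g) x 1 /\
                        C * lam ^+ n <= `|derive1 (iter n g) x|.

Definition preim_iter (F : R -> R -> R) (t : R) (j : nat) (A : set R) : set R :=
  [set x | I01 x /\ A (iter j (circ F t) x)].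

Local Open Scope ereal_scope.

Definition circ_prob (mu : {measure set R -> \bar R}) : Prop :=
  mu I01 = 1 /\ mu (~` I01) = 0.

Definition invariant (F : R -> R -> R) (t : R) (mu : {measure set R -> \bar R}) :=
  forall A, measurable A -> A `<=` I01 -> mu (preim_iter F t 1 A) = mu A.

Definition abs_cont (mu : {measure set R -> \bar R}) :=
  forall A, measurable A -> (@lebesgue_measure R) A = 0 -> mu A = 0.

Definition acip (F : R -> R -> R) (t : R) (mu : {measure set R -> \bar R}) :=
  circ_prob mu /\ abs_cont mu /\ invariant F t mu.

Definition ergodic (F : R -> R -> R) (t : R) (mu : {measure set R -> \bar R}) :=
  forall A, measurable A -> A `<=` I01 -> preim_iter F t 1 A = A ->
    mu A = 0 \/ mu (I01 `\` A) = 0.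

Definition unique_ergodic_acip (F : R -> R -> R) (t : R)
    (mu : {measure set R -> \bar R}) :=
  acip F t mu /\ ergodic F t mu /\
  forall nu : {measure set R -> \bar R}, acip F t nu -> ergodic F t nu ->
    forall A, measurable A -> nu A = mu A.

(* continuous functions on M = 1-periodic continuous functions on R *)
Definition circ_cont (phi : R -> R) : Prop :=
  continuous phi /\ forall x, phi (x + 1)%R = phi x.

Definition weak_star_acc_point (mu : R -> {measure set R -> \bar R})
    (t0 : R) (mu0 : {measure set R -> \bar R}) : Prop :=
  mu0 (~` I01) = 0 /\
  exists tn : nat -> R, (forall n, (0 < tn n < t0)%R) /\ tn @ \oo --> (0%R : R) /\
    forall phi, circ_cont phi ->
      (fun n => \int[mu (tn n)]_(x in I01) (phi x)%:E) @ \oo -->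
        \int[mu0]_(x in I01) (phi x)%:E.

Definition finite_partition (k : nat) (A : nat -> set R) : Prop :=
  (forall i, (i < k)%N -> measurable (A i) /\ A i `<=` I01) /\
  (forall i j, (i < k)%N -> (j < k)%N -> i <> j -> A i `&` A j = set0) /\
  \bigcup_(i in [set i | (i < k)%N]) A i = I01.

(* xi = {A i} is generating for f_t mod mu : the sigma-algebra generated by
   the f_t^{-j}(A i) (i.e. \/_{j>=0} f_t^{-j} xi) is the Borel sigma-algebra
   of M modulo mu-null sets *)
Definition generating (F : R -> R -> R) (t : R) (mu : {measure set R -> \bar R})
    (k : nat) (A : nat -> set R) : Prop :=
  forall B, measurable B -> B `<=` I01 ->
    exists C, <<s I01, [set P | exists j i, (i < k)%N /\ P = preim_iter F t j (A i)] >> C /\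
      mu ((B `\` C) `|` (C `\` B)) = 0.

(* boundary in M of an atom A (seen inside the fundamental domain) *)
Definition circ_boundary (A : set R) : set R :=
  let P := [set x | A (fracpart x)] in I01 `&` (closure P `\` interior P).

End Circle.

(* Main.v *)
Require Import Defs.
From HB Require Import structures.
From mathcomp Require Import all_boot all_order all_algebra.
From mathcomp Require Import all_classical all_reals all_analysis.
From mathcomp Require Import lra ring.
Import Order.TTheory GRing.Theory Num.Theory.
Import numFieldNormedType.Exports.
Local Open Scope classical_set_scope.
Local Open Scope ring_scope.
Set Implicit Arguments. Unset Strict Implicit.

(* Cut the circle into N arcs of length 1/N. By compactness the lifts F_t,
   0 <= t <= t0, share a Lipschitz constant L; take N >= max(2, 2 L). If two points
   have the same first n symbols, the arcs between them never wrap around the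
   circle, so expansion forces the points to be exponentially close in n. Hence
   open sets are countable unions of cylinders, for every t at once. Translating
   the partition moves its endpoints through disjoint sets, and the finite measure
   mu_0 charges only countably many of them, so some translate has null boundary. *)

Lemma intr_norm_lt1 (R : realType) (m : int) : `|m%:~R : R| < 1 -> m = 0.
Proof.
rewrite -intr_norm ltrz1 -[ltRHS]add0r ltzD1 => m0.
by apply/eqP; rewrite -normr_eq0 eq_le normr_ge0 andbT.
Qed.

(** * Mean value estimates and integer translations for lifts *)

Section LiftedDynamics.
Variable R : realType.

Lemma fracpart_itv (x : R) : 0 <= fracpart x < 1.
Proof.
by have := floor_itv x; rewrite /fracpart intrD; lra.
Qed.

Lemma mvt_eq (f : R -> R) (x y : R) : (forall z, derivable f z 1) ->
  exists c, (Num.min x y <= c <= Num.max x y) /\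
    f x - f y = derive1 f c * (x - y).
Proof.
move=> df.
have main a b : a <= b ->
    exists c, (a <= c <= b) /\ f b - f a = derive1 f c * (b - a).
  move=> ab.
  have [||c cab ->] := @MVT_segment R f (derive1 f) a b ab.
  - by move=> z _; rewrite derive1E; exact: DeriveDef.
  - by apply: derivable_within_continuous => z _; exact: df.
  - by exists c; split => //; move: cab; rewrite in_itv.
have [xy|yx] := leP x y.
  have [c [cxy e]] := main x y xy; exists c; split; first by [].
  by rewrite -[LHS]opprB e -mulrN opprB.
by have [c [cyx e]] := main y x (ltW yx); exists c.
Qed.

(** The iterates act on the line, where the mean value theorem turns the derivative bound into
    expansion of distances at every scale. *)
Lemma unif_expanding_dist (g : R -> R) : unif_expanding g ->
  exists C lam : R, [/\ 0 < C, 1 < lam &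
    forall n x y, C * lam ^+ n * `|x - y| <= `|iter n g x - iter n g y|].
Proof.
move=> [C [lam [C0 [lam1 H]]]]; exists C, lam; split => // n x y.
have [c [_ ->]] := @mvt_eq (iter n g) x y (fun z => (H n z).1).
by rewrite normrM ler_wpM2r// (H n c).2.
Qed.

Variables (g : R -> R) (d : int).
Hypothesis gD1 : forall x, g (x + 1) = g x + d%:~R.

Lemma lift_natD x (n : nat) : g (x + n%:R) = g x + (d * n%:Z)%:~R.
Proof.
elim: n => [|n IH]; first by rewrite mulr0 !addr0.
rewrite -natr1 addrA gD1 IH -addrA -intrD; congr (_ + _%:~R).
by rewrite -[n.+1]addn1 PoszD mulrDr mulr1.
Qed.

Lemma lift_intD x (m : int) : g (x + m%:~R) = g x + (d * m)%:~R.
Proof.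
case: m => n; first exact: lift_natD.
rewrite NegzE mulrN !mulrNz.
have := lift_natD (x - (n.+1)%:~R) n.+1.
by rewrite -[n.+1%:R]/((n.+1)%:~R) subrK => ->; rewrite addrK.
Qed.

Lemma iter_lift_intD x (m : int) j :
  exists k : int, iter j g (x + m%:~R) = iter j g x + k%:~R.
Proof.
elim: j => [|j [k IH]]; first by exists m.
by exists (d * k); rewrite !iterS IH lift_intD.
Qed.

(** Circle orbits and lift orbits differ by integers, so a 1-periodic index takes the same values
    along both. *)
Lemma iter_fracpart x j :
  exists k : int, iter j (fun y => fracpart (g y)) x = iter j g x + k%:~R.
Proof.
elim: j => [|j [k IH]]; first by exists 0; rewrite addr0.
exists (d * k - Num.floor (g (iter j g x + k%:~R))).
by rewrite !iterS IH /fracpart {1}lift_intD intrD mulrNz addrA.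
Qed.

End LiftedDynamics.

(** * Partitions of the circle into arcs *)

Section Arcs.
Variables (R : realType) (N : nat).
Hypothesis N_gt0 : (0 < N)%N.

Let NR_gt0 : 0 < N%:R :> R. Proof. by rewrite ltr0n. Qed.

(* The circle is cut at the points s + m/N into N half-open arcs; the index is
   1-periodic, so that the arc containing 0 needs no special treatment. *)
Definition arc_index (s x : R) : int := (Num.floor (N%:R * (x - s)) %% N%:Z)%Z.

Definition arc (s : R) (i : nat) : set R :=
  [set x | I01 x /\ arc_index s x = i%:Z].

Definition arc_ends (s : R) : set R :=
  [set x | I01 x /\ exists m : int, N%:R * (x - s) = m%:~R].

Lemma arc_indexD s x (m : int) : arc_index s (x + m%:~R) = arc_index s x.
Proof.
rewrite /arc_index.
have -> : N%:R * (x + m%:~R - s) = N%:R * (x - s) + (m * N%:Z)%:~R.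
  by rewrite intrM -[N%:~R]/(N%:R); ring.
by rewrite floorDrz ?intr_int// intrKfloor addrC modzMDl.
Qed.

Lemma arc_index_fracpart s x : arc_index s (fracpart x) = arc_index s x.
Proof. by rewrite /fracpart -mulrNz arc_indexD. Qed.

Lemma arc_index_bounds s x : exists2 i : nat, (i < N)%N & arc_index s x = i%:Z.
Proof.
have h0 : N%:Z != 0 by rewrite eqz_nat -lt0n.
have := modz_ge0 (Num.floor (N%:R * (x - s))) h0.
have := @ltz_pmod (Num.floor (N%:R * (x - s))) N%:Z N_gt0.
rewrite /arc_index; case: (_ %% _)%Z => // i iN _; exists i => //.
Qed.

(** Floors congruent modulo [N] differ by some [m * N]; translating [y] by [m] brings it into the
    cell of length [1/N] that contains [x]. *)
Lemma arc_index_eq_close s x y : arc_index s x = arc_index s y ->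
  exists m : int, `|x - (y + m%:~R)| < N%:R^-1.
Proof.
rewrite /arc_index => e.
set a := Num.floor (N%:R * (x - s)) in e; set b := Num.floor (N%:R * (y - s)) in e.
pose m := (a %/ N%:Z)%Z - (b %/ N%:Z)%Z; exists m.
have em : a = b + m * N%:Z.
  by rewrite (divz_eq a N%:Z) [in RHS](divz_eq b N%:Z) e /m; ring.
clearbody m.
have := floor_itv (N%:R * (x - s)); have := floor_itv (N%:R * (y - s)).
rewrite -/a -/b em !intrD intrM -[N%:~R]/(N%:R) => hb ha.
rewrite -(ltr_pM2l NR_gt0) divff ?gt_eqF// -{1}(gtr0_norm NR_gt0) -normrM.
by rewrite ltr_norml; apply/andP; split; lra.
Qed.

Lemma measurable_arc s i : measurable (arc s i).
Proof.
rewrite (_ : arc s i = @I01 R `&` \bigcup_(m : int)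
   (if (m %% N%:Z)%Z == i%:Z then
     `[s + m%:~R / N%:R, s + (m + 1)%:~R / N%:R[%classic else set0)).
  apply: measurableI; first exact: measurable_itv.
  by apply: countable_bigcupT_measurable => // m; case: ifP.
have cellE m x : (Num.floor (N%:R * (x - s)) == m) =
    (x \in `[s + m%:~R / N%:R, s + (m + 1)%:~R / N%:R[).
  rewrite floor_eq in_itv/= -lerBrDl -ltrBlDl ler_pdivrMr// ltr_pdivlMr//.
  by rewrite (mulrC _ N%:R).
apply/seteqP; split => x /= [x01].
  move=> xi; split => //; exists (Num.floor (N%:R * (x - s))) => //.
  by rewrite -/(arc_index s x) xi eqxx /= -cellE.
move=> [m _]; case: ifP => // /eqP mi /=; rewrite -cellE => /eqP xm.
by split; rewrite // /arc_index xm mi.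
Qed.

Lemma measurable_arc_ends s : measurable (arc_ends s).
Proof.
rewrite (_ : arc_ends s = @I01 R `&` \bigcup_(m : int) [set s + m%:~R / N%:R]).
  apply: measurableI; first exact: measurable_itv.
  by apply: countable_bigcupT_measurable.
apply/seteqP; split => x /= [x01 [m]].
  move=> e; split => //; exists m => //=.
  by rewrite -e mulrAC divff ?gt_eqF// mul1r addrC subrK.
move=> _ xE; split => //; exists m.
by rewrite xE addrAC subrr add0r mulrC divfK// gt_eqF.
Qed.

(** A point shared by two of the sets makes [N * (s' - s)] an integer, of absolute value below 1
    because both parameters lie in an interval of length [1/N]. *)
Lemma trivIset_arc_ends : trivIset `]0, N%:R^-1[ arc_ends.
Proof.
move=> s s' /=; rewrite !in_itv /= => /andP[s0 s1] /andP[s'0 s'1].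
move=> [x [[_ [m xm]] [_ [m' xm']]]].
have e : N%:R * (s' - s) = (m - m')%:~R.
  by rewrite intrD mulrNz -xm -xm'; ring.
have mm0 : m - m' = 0.
  apply: (@intr_norm_lt1 R).
  rewrite -e normrM gtr0_norm// -ltr_pdivlMl// mulr1 ltr_norml.
  by apply/andP; split; lra.
move: e; rewrite mm0 => /eqP.
by rewrite mulf_eq0 gt_eqF//= subr_eq0 => /eqP.
Qed.

Lemma finite_partition_arc s : finite_partition N (arc s).
Proof.
split=> [i _|]; first by split; [exact: measurable_arc|move=> x []].
split=> [i j _ _ ij|].
  by rewrite -subset0 => x [[_ xi] [_ xj]]; case: ij; move: xj; rewrite xi => -[].
apply/seteqP; split => [x [i _ []]//|x x01].
by have [i iN xi] := arc_index_bounds s x; exists i.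
Qed.

(** Away from the cut points the floor is locally constant, so a small neighbourhood lies wholly
    inside or wholly outside the lifted arc. *)
Lemma circ_boundary_arc s i : circ_boundary (arc s i) `<=` arc_ends s.
Proof.
move=> x [x01 [clx intx]]; split => //; exists (Num.floor (N%:R * (x - s))).
apply: contrapT => xne.
have [hl hr] : (Num.floor (N%:R * (x - s)))%:~R < N%:R * (x - s) /\
     N%:R * (x - s) < (Num.floor (N%:R * (x - s)) + 1)%:~R.
  by have /andP[h1 h2] := floor_itv (N%:R * (x - s)); split => //;
    rewrite lt_neqAle h1 andbT; apply/eqP => /esym.
set m := Num.floor _ in hl hr xne.
have ltE a y : (s + a / N%:R < y) = (a < N%:R * (y - s)).
  by rewrite -ltrBrDl ltr_pdivrMr// mulrC.
have gtE a y : (y < s + a / N%:R) = (N%:R * (y - s) < a).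
  by rewrite -ltrBlDl ltr_pdivlMr// mulrC.
have near_m : \forall y \near x, Num.floor (N%:R * (y - s)) = m.
  have : \forall y \near x, y \in `]s + m%:~R / N%:R, s + (m + 1)%:~R / N%:R[.
    by apply: near_in_itvoo; rewrite in_itv/= ltE gtE hl.
  apply: filterS => y; rewrite in_itv/= ltE gtE => /andP[h1 h2].
  by apply/eqP; rewrite floor_eq h2 ltW.
have arcE y : arc s i (fracpart y) <-> (Num.floor (N%:R * (y - s)) %% N%:Z)%Z = i.
  rewrite /arc /= arc_index_fracpart; split => [[]//|e]; split => //.
  by rewrite /I01/= in_itv/= fracpart_itv.
have [y [/arcE ayi yx]] := clx _ near_m.
apply: intx; rewrite /interior /=.
by apply: filterS near_m => z zm; apply/arcE; rewrite zm -ayi yx.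
Qed.

End Arcs.

(** * Set operations in generated sigma-algebras *)

Section GeneratedSigmaAlgebra.
Context {T : Type} (D : set T) (G : set (set T)).

Lemma sigma_algebraU A B : <<s D, G >> A -> <<s D, G >> B -> <<s D, G >> (A `|` B).
Proof.
by move=> sA sB; rewrite -bigcup2E; apply: sigma_algebra_bigcup => -[|[|n]]//=;
  exact: sigma_algebra0.
Qed.

Lemma sigma_algebraI A B : A `<=` D -> <<s D, G >> A -> <<s D, G >> B ->
  <<s D, G >> (A `&` B).
Proof.
move=> AD sA sB; have -> : A `&` B = D `\` ((D `\` A) `|` (D `\` B)).
  apply/seteqP; split=> [x [Ax Bx]|x [Dx nAB]].
    by split; [exact: AD|move=> [] []].
  by split; apply: contrapT => nx; apply: nAB; [left|right].
by apply: sigma_algebraCD; apply: sigma_algebraU; exact: sigma_algebraCD.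
Qed.

End GeneratedSigmaAlgebra.

(** For each [n], only finitely many disjoint subsets of [D] can have measure at least [1/(n+1)];
    the set in question is the union over [n] of these finite sets. *)
Lemma positive_measure_countable (R : realType) (mu : {measure set R -> \bar R})
    (J D : set R) (Z : R -> set R) (M : R) :
  measurable D -> (mu D <= M%:E)%E ->
  (forall s, measurable (Z s)) -> (forall s, Z s `<=` D) -> trivIset J Z ->
  countable [set s | J s /\ mu (Z s) != 0%E].
Proof.
move=> mD muD mZ ZD tZ.
rewrite [X in countable X](_ : _ =
    \bigcup_n [set s | J s /\ (n.+1%:R^-1%:E <= mu (Z s))%E]); last first.
  apply/seteqP; split=> [s [Is s0]|s [n _ [Is sn]]]; last first.
    by split=> //; rewrite gt_eqF// (lt_le_trans _ sn)// lte_fin.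
  have : (0 < mu (Z s))%E by rewrite lt0e s0 measure_ge0.
  case E : (mu (Z s)) => [r| |]//.
    rewrite lte_fin => /ltr_add_invr[n]; rewrite add0r => nr.
    by exists n => //; split=> //; rewrite E lee_fin ltW.
  by exists 0%N => //; split=> //; rewrite E leey.
apply: bigcup_countable => // n _; apply: finite_set_countable.
apply: contrapT => /infiniteP/pcard_leP/injfunPex[/= q q_fun q_inj].
(* [K] disjoint sets of measure at least [1/(n+1)] would exceed the total mass bound [M]. *)
have [K MK] : exists K : nat, M < K%:R * n.+1%:R^-1.
  exists (Num.truncn (M * n.+1%:R)).+1.
  by rewrite ltr_pdivlMr// truncnS_gt.
have : (mu (\bigcup_(k in `I_K) Z (q k)) <= M%:E)%E.
  apply: le_trans muD; apply: le_measure; rewrite ?inE//.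
    by apply: bigcup_measurable => k _; exact: mZ.
  by apply: bigcup_sub => k _; exact: ZD.
rewrite measure_fin_bigcup//; last first.
  move=> i j _ _ ij; apply: q_inj; rewrite ?inE//.
  by apply: tZ => //; [case: (q_fun i Logic.I)|case: (q_fun j Logic.I)].
rewrite -fsbig_ord; apply/negP; rewrite -ltNge.
apply: (@lt_le_trans _ _ (\sum_(k < K) (n.+1%:R^-1)%:E)%E).
  by rewrite sumEFin lte_fin sumr_const card_ord -[ltRHS]mulr_natl.
by apply: lee_sum => k _; case: (q_fun k Logic.I).
Qed.

(** * Itineraries separate points and generate the Borel sets *)

Section Itineraries.
Variables (R : realType) (N : nat) (s : R) (g : R -> R) (d : int) (L C lam : R).
Hypothesis N_ge2 : (2 <= N)%N.
Hypothesis L_ge0 : 0 <= L.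
Hypothesis LN : 2 * L <= N%:R.
Hypothesis gD1 : forall x, g (x + 1) = g x + d%:~R.
Hypothesis g_lip : forall x y, `|x - y| <= 1 -> `|g x - g y| <= L * `|x - y|.
Hypothesis C_gt0 : 0 < C.
Hypothesis lam_gt1 : 1 < lam.
Hypothesis g_exp :
  forall n x y, C * lam ^+ n * `|x - y| <= `|iter n g x - iter n g y|.

Let N_gt0 : (0 < N)%N. Proof. exact: leq_trans N_ge2. Qed.
Let NR_gt0 : 0 < N%:R :> R. Proof. by rewrite ltr0n. Qed.

Let Ninv_le : N%:R^-1 <= 2^-1 :> R.
Proof. by rewrite lef_pV2 ?posrE// ler_nat. Qed.

Definition same_itinerary n (x y : R) := forall j, (j < n)%N ->
  arc_index N s (iter j g x) = arc_index N s (iter j g y).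

(* Two points at distance less than 1/N have images at distance at most 1/2;
   lying in a common arc, these are then less than 1/N apart on the line, not
   only on the circle. *)
Lemma same_itinerary_shadow n x y : `|x - y| < N%:R^-1 ->
  same_itinerary n.+1 x y -> `|iter n g x - iter n g y| < N%:R^-1.
Proof.
move=> xy; elim: n => [//|n IH] xyn.
have {}IH : `|iter n g x - iter n g y| < N%:R^-1.
  by apply: IH => j jn; apply: xyn; exact: ltnW.
have [m hm] := arc_index_eq_close N_gt0 (xyn n.+1 (ltnSn _)).
rewrite !iterS in hm *; set a := iter n g x in IH hm *.
set b := iter n g y in IH hm *.
have ab1 : `|a - b| <= 1 by have := Ninv_le; lra.
(* The choice [2 * L <= N] serves to make [L / N] at most [1/2]. *)
have gab : `|g a - g b| <= 2^-1.
  apply: le_trans (g_lip ab1) _; apply: (@le_trans _ _ (L * N%:R^-1)).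
    by rewrite ler_wpM2l// ltW.
  by rewrite ler_pdivrMr// mulrC ler_pdivlMr// mulrC.
suff m0 : m = 0 by move: hm; rewrite m0 addr0.
apply: (@intr_norm_lt1 R).
have -> : m%:~R = (g a - g b) - (g a - (g b + m%:~R)) by ring.
by apply: le_lt_trans (ler_normB _ _) _; have := Ninv_le; lra.
Qed.

(** The symbols fix [y] only modulo 1, so [y] is first translated to within [1/N] of [x], which
    changes no symbol. The [n]-th images then stay within [1/N], and expansion pulls this bound
    back. *)
Lemma same_itinerary_close n x y : same_itinerary n.+1 x y ->
  exists m : int, C * lam ^+ n * `|x - (y + m%:~R)| < N%:R^-1.
Proof.
move=> xyn; have [m hm] := arc_index_eq_close N_gt0 (xyn 0%N (ltn0Sn _)).
exists m; apply: le_lt_trans (g_exp _ _ _) _.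
apply: same_itinerary_shadow => // j jn.
by have [k ->] := iter_lift_intD gD1 y m j; rewrite arc_indexD xyn.
Qed.

Lemma same_itinerary_lt (e : R) : 0 < e ->
  exists n, forall x y, same_itinerary n x y -> exists m : int, `|x - (y + m%:~R)| < e.
Proof.
move=> e0.
have lam_gt0 : 0 < lam by apply: lt_trans lam_gt1.
have : `|lam^-1| < 1 by rewrite gtr0_norm ?invr_gt0// invf_lt1.
(* The threshold [e * C] gives [1 < e * C * lam ^ n], while the scaled distance is below [1/N],
   hence below 1. *)
move=> /cvg_expr/cvgr0Pnorm_lt/(_ (e * C) (mulr_gt0 e0 C_gt0)) [n _ /(_ n (leqnn _))] /=.
rewrite exprVn gtr0_norm ?invr_gt0 ?exprn_gt0// => hn.
exists n.+1 => x y /same_itinerary_close[m hm]; exists m.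
have ln0 : 0 < lam ^+ n by rewrite exprn_gt0.
move: hn; rewrite -[X in X < _]mul1r ltr_pdivrMr// => hn.
rewrite -(ltr_pM2l (mulr_gt0 C_gt0 ln0)); apply: lt_trans hm _.
by have := Ninv_le; nra.
Qed.

Variable G : set (set R).
Hypothesis G_cyl : forall j i, (i < N)%N ->
  G [set x | I01 x /\ arc_index N s (iter j g x) = i%:Z].

(** Such an [S] is a finite union of cylinders of length [n]; the induction peels off the last
    symbol. *)
Lemma saturated_sigma_algebra n (S : set R) : S `<=` @I01 R ->
  (forall x y, S x -> I01 y -> same_itinerary n x y -> S y) ->
  <<s @I01 R, G >> S.
Proof.
elim: n S => [|n IH] S SI sat.
  (* With no symbols to compare, [S] is empty or all of [I01]. *)
  have [->|/set0P[x Sx]] := eqVneq S set0; first exact: sigma_algebra0.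
  have -> : S = @I01 R `\` set0.
    by rewrite setD0; apply/seteqP; split=> // y Iy; apply: (sat x).
  by apply: sigma_algebraCD; exact: sigma_algebra0.
pose cyl i := [set x | I01 x /\ arc_index N s (iter n g x) = i%:Z].
(* [S_ i] is determined by the first [n] symbols, so the induction hypothesis applies to it; [cyl i]
   restores the last symbol. *)
pose S_ i := [set x | I01 x /\ exists2 y, S y &
  same_itinerary n y x /\ arc_index N s (iter n g y) = i%:Z].
have -> : S = \bigcup_i (if (i < N)%N then cyl i `&` S_ i else set0).
  apply/seteqP; split=> [x Sx|x [i _]].
    have [i iN xi] := arc_index_bounds N_gt0 s (iter n g x).
    exists i; rewrite // iN; split; split=> //; try exact: SI.
    by exists x.
  case: ifP => // iN [[Ix xi] [_ [y Sy [yx yi]]]].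
  apply: (sat y) => // j; rewrite ltnS leq_eqVlt => /predU1P[->|jn].
    by rewrite yi xi.
  exact: yx.
apply: sigma_algebra_bigcup => i; case: ifP => iN; last exact: sigma_algebra0.
apply: sigma_algebraI; first by move=> x [].
  by apply: sub_sigma_algebra; exact: G_cyl.
apply: IH => [x []//|x y [Ix [z Sz [zx zi]]] Iy xy]; split=> //.
by exists z => //; split=> // j jn; rewrite zx// xy.
Qed.

(** [U] is the union over [n] of its largest subsets saturated for [n] symbols; they exhaust [U]
    because points with long common itineraries are close. *)
Lemma open_sigma_algebra (U : set R) : open U -> U `<=` `]0, 1[ ->
  <<s @I01 R, G >> U.
Proof.
move=> oU U01.
have UI : U `<=` @I01 R by move=> x /U01; rewrite /I01/= !in_itv/= => /andP[/ltW-> ->].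
have -> : U = \bigcup_n [set x | U x /\
    forall y, I01 y -> same_itinerary n x y -> U y].
  apply/seteqP; split=> [x Ux|x [n _ []]//].
  have [e /= e0 xeU] := (nbhs_ballP _ _).1 (open_nbhs_nbhs (conj oU Ux)).
  have := U01 x Ux; rewrite /= in_itv/= => /andP[x0 x1].
  (* The bounds [x] and [1 - x] put [y + m] in the open unit interval, which forces [m = 0]; [e]
     keeps [y] in [U]. *)
  have [|n hn] := @same_itinerary_lt (Num.min e (Num.min x (1 - x))).
    by rewrite !lt_min e0 x0 subr_gt0.
  exists n => //; split=> // y Iy /hn[m].
  rewrite !lt_min => /and3P[me mx mx1]; apply: xeU; rewrite /ball/=.
  suff m0 : m = 0 by move: me; rewrite m0 addr0.
  move: Iy; rewrite /I01/= in_itv/= => /andP[y0 y1].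
  apply: (@intr_norm_lt1 R); move: mx mx1.
  by rewrite !ltr_norml => /andP[? ?] /andP[? ?]; apply/andP; split; lra.
apply: sigma_algebra_bigcup => n.
apply: (@saturated_sigma_algebra n) => [x [/UI]//|x y [Ux xn] Iy xy].
split; first exact: xn.
by move=> z Iz yz; apply: xn => // j jn; rewrite xy// yz.
Qed.

(** Open intervals generate the Borel sets. Their traces on [I01] split into an open part and a part
    of the point 0, itself the complement of the open unit interval. *)
Lemma measurable_sigma_algebra (B : set R) : measurable B -> B `<=` @I01 R ->
  <<s @I01 R, G >> B.
Proof.
move=> mB BI; rewrite -(setIidl BI).
have s01 : <<s @I01 R, G >> `]0, 1[%classic.
  by apply: open_sigma_algebra => //; exact: itv_open.
have s0 : <<s @I01 R, G >> [set 0].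
  have -> : [set (0 : R)] = @I01 R `\` `]0, 1[%classic.
    apply/seteqP; split=> [_ ->|x]; rewrite /I01/= !in_itv/=.
      by rewrite lexx ltr01 ltxx.
    move=> [/andP[x0 ->]]; rewrite andbT => /negP; rewrite -leNgt => x0'.
    by apply/eqP; rewrite eq_le x0'.
  exact: sigma_algebraCD.
have I01E : @I01 R = `]0, 1[%classic `|` [set 0].
  apply/seteqP; split=> [x|x []]; rewrite /I01/= !in_itv/=.
  - by rewrite le_eqVlt => /andP[/predU1P[<-|->] ->]; [right|left].
  - by move=> /andP[/ltW-> ->].
  - by move=> ->; rewrite lexx ltr01.
suff : (@measurable _ R) `<=` [set A | <<s @I01 R, G >> (A `&` @I01 R)] by exact.
rewrite [X in X `<=` _](_ : _ = (@ocitv R).-sigma.-measurable)//.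
rewrite measurable_realfun.RGenOpens.measurableE; apply: smallest_sub.
  split=> [/=|A /= sA|A sA /=].
  - by rewrite set0I; exact: sigma_algebra0.
  - rewrite (_ : _ `&` _ = @I01 R `\` (A `&` @I01 R)); first exact: sigma_algebraCD.
    apply/seteqP; split=> [x [[_ Ax] Ix]|x [Ix nAx]]; first by split=> // -[].
    by split=> //; split=> // Ax; apply: nAx.
  - by rewrite setI_bigcupl; exact: sigma_algebra_bigcup.
move=> _ [a [b ->]] /=; rewrite [X in _ `&` X]I01E setIUr; apply: sigma_algebraU.
  apply: open_sigma_algebra; last by move=> x [].
  by apply: openI; exact: itv_open.
have [ab0|ab0] := pselect (`]a, b[%classic 0).
  by rewrite (_ : _ `&` _ = [set 0])//; apply/seteqP; split=> [x []//|_ ->].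
rewrite (_ : _ `&` _ = set0); first exact: sigma_algebra0.
by rewrite -subset0 => x [/[swap] ->].
Qed.

End Itineraries.

(** * Uniform Lipschitz bound, choice of the cuts, mass of the limit *)

Section LiftFamily.
Variable R : realType.

Lemma lift_family_lipschitz (F : R -> R -> R) (t0 : R) :
  C1_2var F -> circle_local_diffeo_family F ->
  exists2 L : R, 0 <= L & forall t x y, 0 <= t <= t0 -> `|x - y| <= 1 ->
    `|F x t - F y t| <= L * `|x - y|.
Proof.
move=> [dFx [_ [_ [cdF _]]]] [[d FD1] _].
(* After an integer translation [x] lies in [[0, 1)], so [y] and the mean value point lie in
   [[-1, 2]]. *)
pose K := (`[-1, 2] `*` `[0, t0])%classic : set (R * R).
have cK : compact [set dx F p.1 p.2 | p in K].
  apply: continuous_compact; first exact: continuous_subspaceT.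
  by apply: compact_setX; exact: segment_compact.
have [M [_ hM]] := compact_bounded cK.
have L_gtM : M < `|M| + 1 by have := ler_norm M; lra.
exists (`|M| + 1) => [|t x y tt xy]; first exact: addr_ge0.
pose k := - Num.floor x.
have shift z : F (z + k%:~R) t = F z t + (d * k)%:~R.
  exact: (@lift_intD R (F^~ t) d (fun z => FD1 z t)).
have -> : F x t - F y t = F (x + k%:~R) t - F (y + k%:~R) t.
  by rewrite !shift opprD addrACA subrr addr0.
have -> : x - y = (x + k%:~R) - (y + k%:~R) by ring.
have [c [cxy ->]] := @mvt_eq R (F^~ t) (x + k%:~R) (y + k%:~R) (fun z => dFx z t).
rewrite normrM ler_wpM2r//.
apply: (hM _ L_gtM); exists (c, t) => //; split; rewrite /= in_itv/= ?tt//.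
have := fracpart_itv x; rewrite /fracpart -mulrNz -/k => hx.
by move: cxy xy; rewrite ge_min le_max ler_norml => /andP[/orP h1 /orP h2] /andP[? ?];
  apply/andP; split; [case: h1|case: h2] => ?; lra.
Qed.

(** Otherwise every parameter in []0, 1/N[] has cut points of positive measure, and this interval
    would be countable. *)
Lemma exists_null_arc_ends (mu : {measure set R -> \bar R}) (N : nat) :
  (0 < N)%N -> (mu (@I01 R) < +oo)%E -> exists s, mu (arc_ends N s) = 0%E.
Proof.
move=> N0 muI.
have muI' : (mu (@I01 R) <= (fine (mu (@I01 R)))%:E)%E.
  by rewrite fineK// ge0_fin_numE.
apply: contrapT => noS.
have /countable_lebesgue_measure0 :=
  @positive_measure_countable R mu `]0, N%:R^-1[%classic (@I01 R) (arc_ends N) _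
    (measurable_itv _) muI' (measurable_arc_ends N0)
    (fun s x => @proj1 _ _) (trivIset_arc_ends N0).
rewrite (_ : [set s | _] = `]0, N%:R^-1[%classic).
  rewrite lebesgue_measure_itv/= lte_fin invr_gt0 ltr0n N0 oppr0 adde0 => -[/eqP].
  by rewrite invr_eq0 pnatr_eq0 eqn0Ngt N0.
apply/seteqP; split=> [s []//|s sI]; split=> //.
by apply/eqP => s0; apply: noS; exists s.
Qed.

(** The constant function 1 is an admissible test function on the compact circle, so no mass is
    lost. *)
Lemma weak_star_acc_point_mass (t0 : R)
    (mu : R -> {measure set R -> \bar R}) (mu0 : {measure set R -> \bar R}) :
  (forall t, 0 < t < t0 -> mu t (@I01 R) = 1%E) ->
  weak_star_acc_point mu t0 mu0 -> mu0 (@I01 R) = 1%E.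
Proof.
move=> mu1 [_ [tn [tnt [_ /(_ (fun=> 1)) cv]]]].
have int1 (nu : {measure set R -> \bar R}) :
    (\int[nu]_(x in @I01 R) 1%:E)%E = nu (@I01 R).
  by rewrite integral_cst ?mul1e//; exact: measurable_itv.
have {}cv : (fun n => mu (tn n) (@I01 R)) @ \oo --> mu0 (@I01 R).
  rewrite -int1 [X in X @ _](_ : _ =
    fun n => (\int[mu (tn n)]_(x in @I01 R) 1%:E)%E); last first.
    by apply/funext => n; rewrite int1.
  by apply: cv; split=> // x; exact: cvg_cst.
have mutn : (fun n => mu (tn n) (@I01 R)) = (fun=> 1%E).
  by apply/funext => n; exact: mu1.
by move: cv; rewrite mutn => cv; apply/esym/(cvg_unique _ (cvg_cst _) cv).
Qed.

End LiftFamily.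

Unset Implicit Arguments.

Theorem theorem4p3 (R : realType) (F : R -> R -> R) (t0 : R)
  (mu : R -> {measure set R -> \bar R}) (mu0 : {measure set R -> \bar R}) :
  generic_unfolding F ->
  (* 0 is the unique saddle-node fixed point of f_0 *)
  saddle_node_fixed (fun x => F x 0) 0 ->
  (forall p, saddle_node_fixed (fun x => F x 0) p -> fracpart p = 0) ->
  (* |f_0'| > 1 off W_0 *)
  (forall x, ~ W0lift (fun y => F y 0) x -> 1 < `|dx F x 0|) ->
  0 < t0 ->
  (forall t, 0 < t < t0 ->
     unif_expanding (fun x => F x t) /\ unique_ergodic_acip F t (mu t)) ->
  weak_star_acc_point mu t0 mu0 ->
  exists (k : nat) (A : nat -> set R),
    finite_partition k A /\
    (forall t, 0 < t < t0 -> generating F t (mu t) k A) /\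
    (forall i, (i < k)%N -> mu0 (circ_boundary (A i)) = 0%E).
Proof.
move=> [[C1F _] [famF _]] _ _ _ t0_gt0 hyp acc.
have mu0I : mu0 (@I01 R) = 1%E.
  by apply: weak_star_acc_point_mass acc => t /hyp[_ [[[]]]].
have [L L0 lip] := lift_family_lipschitz t0 C1F famF.
have [[d FD1] _] := famF.
(* One successor exceeds [2 * L]; the second ensures [N >= 2]. *)
pose N := (Num.truncn (2 * L)).+2.
have LN : 2 * L <= N%:R.
  by rewrite ltW// (lt_trans (truncnS_gt _))// ltr_nat.
have [s ends0] : exists s, mu0 (arc_ends N s) = 0%E.
  by apply: exists_null_arc_ends; rewrite ?mu0I ?ltry.
exists N, (arc N s); split; first exact: finite_partition_arc.
split=> [t tt B mB BI|i iN]; last first.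
  apply: (subset_measure0 _ (measurable_arc_ends _ s) _ ends0) => //.
  - apply: measurableI; first exact: measurable_itv.
    apply: measurableD; first by apply: measurable_realfun.closed_measurable; exact: closed_closure.
    by apply: measurable_realfun.open_measurable; exact: open_interior.
  - exact: circ_boundary_arc.
(* Every Borel subset of [I01] lies in the generated sigma-algebra itself, so the null-set error is
   empty. *)
exists B; split; last by rewrite setDv setU0 measure0.
have [expF _] := hyp t tt.
(* These rates may depend on [t]; [N] and [s] were fixed before [t]. *)
have [C [lam [C0 lam1 g_exp]]] := unif_expanding_dist expF.
have gD1 x : F (x + 1) t = F x t + d%:~R by exact: FD1.
apply: (@measurable_sigma_algebra R N s (F^~ t) d L C lam) => //.
- move=> x y; apply: lip; by case/andP: tt => /ltW-> /ltW->.
- move=> j i iN /=; exists j, i; split=> //.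
  have idxE x : arc_index N s (iter j (circ F t) x) = arc_index N s (iter j (F^~ t) x).
    by have [k ->] := iter_fracpart gD1 x j; rewrite arc_indexD.
  apply/seteqP; split=> x /= [Ix xi]; split=> //; last by move: xi => []; rewrite idxE.
  split; last by rewrite idxE.
  (* An atom lies in [I01], so the iterate must too: for [j = 0] it is [x], afterwards it is a
     fractional part. *)
  case: {xi} j {idxE} => [//|j].
  by rewrite iterS /circ /I01/= in_itv/= fracpart_itv.
Qed.
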